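(* Let $F$ and $G$ be fixed graphs with odd girth $g_o(F)=g_o(G)=k$ such that there exist a homomorphism from $F$ to $C_k$ and a homomorphism from $G$ to $C_k$. Then $\mathrm{ex}_F(n,G)=n^{2-o(1)}$ as $n\to\infty$. Specifically, $\mathrm{ex}_{C_k}(n,C_k)=n^{2-o(1)}$ for every odd integer $k\ge 3$.
   Context: All graphs are finite and simple. $C_k$ denotes the cycle of length $k$. The odd girth $g_o(G)$ of a graph $G$ is the length of a shortest odd cycle of $G$ (so here $k\ge 3$ is odd). For graphs $F$ and $G$, the $F$-multicolor Turán number $\mathrm{ex}_F(n,G)$ is the maximum number of pairwise edge-disjoint copies of $F$ on a common vertex set of $n$ vertices such that the union of these copies contains no copy of $G$ whose edges all come from pairwise distinct copies of $F$ in the family (that is, giving each chosen copy of $F$ its own color, there is no rainbow copy of $G$). The notation $f(n)=n^{2-o(1)}$ means $f(n)=n^{2-\delta(n)}$ for some function $\delta(n)\to 0$ as $n\to\infty$. *)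

(* Defs.v *)
From mathcomp Require Import all_boot all_order all_algebra.
From mathcomp Require Import boolp classical_sets reals topology normedtype.
From mathcomp Require Import sequences exp.

Set Implicit Arguments.
Unset Strict Implicit.
Unset Printing Implicit Defensive.

Import Order.TTheory GRing.Theory Num.Theory.
Import numFieldNormedType.Exports.

Local Open Scope set_scope.
Local Open Scope nat_scope.

Record sgraph := SGraph {
  vertex :> finType;
  adj : rel vertex;
  adj_sym : symmetric adj;
  adj_irrefl : irreflexive adj
}.

Definition edges (G : sgraph) : {set {set G}} :=
  [set [set p.1; p.2] | p : G * G & adj p.1 p.2].

Definition hom (F G : sgraph) (f : F -> G) : Prop :=
  forall x y, adj x y -> adj (f x) (f y).

Definition has_hom (F G : sgraph) : Prop := exists f : F -> G, hom f.

(* This is the cycle C_k only for k >= 3: C_1 has no edge and C_2 is a single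
   edge. *)
Definition cycle_adj (k : nat) : rel 'I_k :=
  fun i j => (i != j) && ((ordS i == j) || (ordS j == i)).

Lemma cycle_adj_sym k : symmetric (@cycle_adj k).
Proof. by move=> i j; rewrite /cycle_adj eq_sym orbC. Qed.

Lemma cycle_adj_irrefl k : irreflexive (@cycle_adj k).
Proof. by move=> i; rewrite /cycle_adj eqxx. Qed.

Definition cycle_graph (k : nat) : sgraph :=
  SGraph (@cycle_adj_sym k) (@cycle_adj_irrefl k).

Definition has_cycle (G : sgraph) (k : nat) : Prop :=
  2 < k /\ exists c : seq G, ucycle (@adj G) c /\ size c = k.

(* A relation rather than a function, since a bipartite graph has no odd
   girth. *)
Definition odd_girth (G : sgraph) (k : nat) : Prop :=
  [/\ odd k, has_cycle G k & forall l, odd l -> has_cycle G l -> k <= l].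

(* A subgraph of the complete graph on V: its vertex set and its edge set. *)
Notation subgraph V := ({set V} * {set {set V}})%type (only parsing).

Definition image_subgraph (F : sgraph) (V : finType) (f : F -> V) :
    subgraph V :=
  (f @: [set: F], [set f @: (e : {set F}) | e in edges F]).

Definition is_copy (F : sgraph) (V : finType) (H : subgraph V) : bool :=
  [exists f : {ffun F -> V}, injectiveb f && (H == image_subgraph f)].

Definition copy_packing (F : sgraph) (V : finType)
    (S : {set (subgraph V)}) : bool :=
  [forall H in S, is_copy F H] &&
  [forall H in S, forall H' in S, (H != H') ==> [disjoint H.2 & H'.2]].

(* The colors are the members of S: g embeds G and c picks, for each edge of G,
   a member of S containing the image of that edge. *)
Definition rainbow_copy (G : sgraph) (V : finType)
    (S : {set (subgraph V)}) : bool :=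
  [exists g : {ffun G -> V},
   exists c : {ffun {set G} -> subgraph V},
    [&& injectiveb g,
        [forall e in edges G, (c e \in S) && (g @: (e : {set G}) \in (c e).2)]
      & [forall e in edges G, forall e' in edges G,
           (c e == c e') ==> (e == e')]]].

Definition multicolor_turan (F G : sgraph) (n : nat) : nat :=
  \max_(S : {set (subgraph 'I_n)} |
        copy_packing F S && ~~ rainbow_copy G S) #|S|.

Local Open Scope classical_set_scope.
Local Open Scope ring_scope.

(* f(n) = n^(2 - o(1)); the equality is only required for large n, as f may
   vanish for small n. *)
Definition eq_n2_o1 (R : realType) (f : nat -> nat) : Prop :=
  exists delta : nat -> R,
    (delta n @[n --> \oo] --> (0 : R)) /\
    (\forall n \near \oo, (f n)%:R = (n%:R : R) `^ (2 - delta n)).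

(* Main.v *)
(** Let phi : F -> C_k be a homomorphism.  On the vertex set F x [kN], take for
    all x < N and a in A the copy of F sending u to (u, x + phi(u) a), where
    A is a Behrend-type subset of [N] on which a_1 + ... + a_k = k b forces
    a_1 = ... = a_k = b.  Two points of a copy lying on a common edge determine
    x and a, so the copies are edge-disjoint.  A rainbow G would contain a
    rainbow cycle of length k, whose edges lie in copies (x_i, a_i).  Along it
    the value of phi changes by +-1, or by +-(k - 1) when it passes the closing
    edge of C_k; as k is odd, the changes can only add up to 0 when the walk
    winds exactly once around C_k.  Adding up the second coordinates then gives
    a_1 + ... + a_k = k a_j, so all copies involved coincide.

    For A, take digit vectors in {0, ..., d - 1}^D on a common sphere, read in
    base k d so that adding k of them creates no carries.  Keeping D fixed and
    letting d grow already gives exponent 2 - O(1 / D). *)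

Require Import Defs.
From mathcomp Require Import all_boot all_order all_algebra.
From mathcomp Require Import reals.
From mathcomp Require Import boolp classical_sets topology normedtype.
From mathcomp Require Import sequences exp.
From mathcomp Require Import zify ring lra.

Set Implicit Arguments.
Unset Strict Implicit.
Unset Printing Implicit Defensive.

Import Order.TTheory GRing.Theory Num.Theory.
Import numFieldNormedType.Exports.

Local Open Scope nat_scope.

(** * Behrend-type sets from digit vectors on a sphere *)

Lemma digits_inj (B D : nat) (f g : nat -> nat) :
  (forall j, f j < B) -> (forall j, g j < B) ->
  \sum_(j < D) f j * B ^ j = \sum_(j < D) g j * B ^ j ->
  forall j, j < D -> f j = g j.
Proof.
elim: D f g => [//|D IHD] f g fB gB.
rewrite !big_ord_recl !expn0 !muln1.
have shift (h : nat -> nat) : \sum_(i < D) h (lift ord0 i) * B ^ (lift ord0 i) =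
    (\sum_(i < D) h i.+1 * B ^ i) * B.
  by rewrite big_distrl; apply: eq_bigr => i _; rewrite /= expnSr mulnA.
rewrite !shift => eq_fg.
have f0 : f 0 = g 0.
  have := congr1 (modn^~ B) eq_fg.
  by rewrite /= ![_ + _ * B]addnC !modnMDl !modn_small.
have B_gt0 : 0 < B by apply: leq_ltn_trans (fB 0).
case=> [//|j]; rewrite ltnS => jD.
apply: (IHD (f \o succn) (g \o succn)) => //=.
apply/eqP; rewrite -(eqn_pmul2r B_gt0); apply/eqP.
by move: eq_fg; rewrite f0 => /addnI.
Qed.

Lemma sum_Posz (I : Type) (r : seq I) (F : I -> nat) :
  (\sum_(i <- r) (F i)%:Z = (\sum_(i <- r) F i)%N%:Z)%R.
Proof. by rewrite (big_morph Posz PoszD erefl). Qed.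

(** Summing |x_i - b|^2 = |x_i|^2 + |b|^2 - 2 <b, x_i> over i gives k r + k r - 2 k r = 0, because
    the x_i add up to k b. Hence every square vanishes. *)
Lemma sphere_mean_rigid (k D : nat) (x : 'I_k -> 'I_D -> nat)
    (b : 'I_D -> nat) (r : nat) :
  (forall i, \sum_j x i j ^ 2 = r) -> \sum_j b j ^ 2 = r ->
  (forall j, \sum_i x i j = k * b j) -> forall i j, x i j = b j.
Proof.
move=> xr br mean i j.
have dist0 : (\sum_i \sum_j ((x i j)%:Z - (b j)%:Z) ^+ 2 = 0)%R.
  pose s (i : 'I_k) (j : 'I_D) : int :=
    ((x i j ^ 2)%N%:Z + (b j ^ 2)%N%:Z - 2%:Z * ((b j)%:Z * (x i j)%:Z))%R.
  rewrite (eq_bigr (fun i => \sum_j s i j)%R); last first.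
    by move=> i' _; apply: eq_bigr => j' _; rewrite /s; lia.
  rewrite /s; under eq_bigr do rewrite !big_split /=.
  under eq_bigr do rewrite !sum_Posz xr br.
  rewrite big_split /= sumr_const card_ord exchange_big /=.
  under [X in (_ + X)%R]eq_bigr => j' _ do
    rewrite sumrN -mulr_sumr -mulr_sumr sum_Posz mean.
  rewrite sumrN -mulr_sumr.
  under [X in (_ - _ * X)%R]eq_bigr => j' _ do
    rewrite -PoszM mulnCA mulnn.
  by rewrite sum_Posz -big_distrr /= br; lia.
have sq_ge0 i' j' : (0 <= ((x i' j')%:Z - (b j')%:Z) ^+ 2)%R by exact: sqr_ge0.
have /(_ i isT) row0 := psumr_eq0P
  (fun i' _ => sumr_ge0 _ (fun j' _ => sq_ge0 i' j')) dist0.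
have /(_ j isT)/eqP := psumr_eq0P (fun j' _ => sq_ge0 i j') row0.
by rewrite sqrf_eq0 subr_eq0 => /eqP [].
Qed.

Lemma popular_fibre (T : finType) (M : nat) (h : T -> nat) :
  0 < M -> (forall x, h x < M) ->
  exists r, #|T| <= #|[set x | h x == r]| * M.
Proof.
move=> M_gt0 hM; pose c (r : 'I_M) := #|[set x | h x == r]|.
have ->: #|T| = \sum_r c r.
  rewrite /c -sum1_card (partition_big (fun x => Ordinal (hM x)) xpredT) //=.
  by apply: eq_bigr => r _; rewrite -sum1dep_card; apply: eq_bigl.
have [r _ rmax] := @arg_maxnP _ (Ordinal M_gt0) xpredT c isT.
exists (val r); rewrite -/(c r) mulnC.
apply: leq_trans (leq_sum _ (fun i _ => rmax i isT)) _.
by rewrite sum_nat_const card_ord.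
Qed.

(** The squared norm takes at most D d^2 values on the d^D digit vectors, so by pigeonhole some
    sphere carries at least d^D / (D d^2) of them. *)
Lemma behrend (k D d : nat) : 0 < k -> 0 < D -> 0 < d ->
  exists A : {set 'I_((k * d) ^ D)},
    d ^ D <= #|A| * (D * d ^ 2) /\
    forall (a : 'I_k -> 'I_((k * d) ^ D)) b,
      (forall i, a i \in A) -> b \in A -> \sum_i a i = k * b ->
      forall i, a i = b.
Proof.
move=> k_gt0 D_gt0 d_gt0; set B := k * d.
pose T := {ffun 'I_D -> 'I_d}.
pose nrm (x : T) := \sum_j x j ^ 2.
have nrm_lt x : nrm x < D * d ^ 2.
  apply: (@leq_ltn_trans (\sum_(j < D) d.-1 ^ 2)).
    by apply: leq_sum => j _; rewrite leq_sqr; have := ltn_ord (x j); lia.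
  by rewrite sum_nat_const card_ord ltn_pmul2l // ltn_sqr; lia.
have M_gt0 : 0 < D * d ^ 2 by rewrite muln_gt0 D_gt0 expn_gt0 d_gt0.
have [r] := popular_fibre M_gt0 nrm_lt.
rewrite card_ffun !card_ord => big_r.
(* [digits_inj] works with digit sequences on [nat], so vectors are extended by 0 from position D
   on. *)
pose digit (x : T) (j : nat) : nat := oapp (fun j => x j : nat) 0 (insub j).
have digitE x (j : 'I_D) : digit x j = x j by rewrite /digit valK.
have digit_lt x j : digit x j < d.
  by rewrite /digit; case: insubP => //= ? _ _.
pose code (x : T) := \sum_(j < D) x j * B ^ j.
have code_lt x : code x < B ^ D.
  have dB : d <= B by rewrite leq_pmull.
  suff: forall (E : nat) (h : nat -> nat), (forall j, h j < B) ->
      \sum_(j < E) h j * B ^ j < B ^ E.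
    move=> /(_ D (digit x)); rewrite /code.
    under eq_bigr => j _ do rewrite digitE.
    by apply=> j; apply: leq_trans dB.
  elim=> [|E IHE] h hB; first by rewrite big_ord0.
  rewrite big_ord_recr /= expnS.
  have := IHE h hB; have := hB E; move: (\sum_(j < E) _) (B ^ E) => s p.
  by move=> hE sp; apply: (@leq_trans (p + h E * p)); [lia|nia].
pose enc x := Ordinal (code_lt x).
have lin (a : 'I_k -> T) (b : T) : \sum_i code (a i) = k * code b ->
    forall j : 'I_D, \sum_i a i j = k * b j.
  move=> eq_ab j.
  have := @digits_inj B D (fun j => \sum_i digit (a i) j)
    (fun j => k * digit b j).
  move=> /(_ _ _ _ j (ltn_ord j)); rewrite digitE.
  under eq_bigr do rewrite digitE.
  apply.
  (* No carries: a sum of k digits is at most k (d - 1), below the base k d. *)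
  - move=> {}j; apply: (@leq_ltn_trans (\sum_(i < k) d.-1)).
      by apply: leq_sum => i _; have := digit_lt (a i) j; lia.
    by rewrite sum_nat_const card_ord ltn_pmul2l; lia.
  - by move=> {}j; rewrite ltn_pmul2l.
  move: eq_ab; rewrite /code exchange_big big_distrr /= => eq_ab.
  under eq_bigr => j' _.
    rewrite (eq_bigr (fun i => a i j' : nat)); last first.
      by move=> ? _; rewrite digitE.
    rewrite big_distrl /=; over.
  by rewrite eq_ab; apply: eq_bigr => j' _; rewrite digitE mulnA.
have encP (a : 'I_k -> T) (b : T) : (forall i, nrm (a i) = r) -> nrm b = r ->
    \sum_i code (a i) = k * code b -> forall i, a i = b.
  move=> ar br /lin ab i; apply/ffunP => j; apply/val_inj.
  exact: (sphere_mean_rigid (x := fun i j => a i j) (b := fun j => b j) ar br).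
have enc_inj : {in [set x | nrm x == r] &, injective enc}.
  move=> x y; rewrite !inE => /eqP xr /eqP yr [exy].
  (* Injectivity is rigidity applied to the constant family x. *)
  apply: (encP (fun=> x) y _ yr _ (Ordinal k_gt0)) => //.
  by rewrite sum_nat_const card_ord exy.
exists [set enc x | x in [set x | nrm x == r]]; split.
  by rewrite card_in_imset.
move=> a b aA /imsetP[y /[!inE]/eqP yr ->] sum_ab i.
have ex i' : exists x, nrm x = r /\ a i' = enc x.
  by have /imsetP[x /[!inE]/eqP xr ->] := aA i'; exists x.
have [x xP] := choice ex.
rewrite (xP i).2; congr enc.
apply: encP => //; first by move=> i'; have [] := xP i'.
by rewrite -sum_ab; apply: eq_bigr => i' _; rewrite (xP i').2.
Qed.

(** * Closed walks on an odd cycle *)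

(* The summand (-1)^t (1 - k c) is the change of residue along a step of C_k,
   with c marking the passage of the closing edge {k - 1, 0}. *)
Lemma closed_walk_winds_once (k : nat) (t c : 'I_k -> bool) (a : 'I_k -> nat) :
  odd k ->
  (\sum_i (-1) ^+ t i * (1 - k%:Z * (c i)%:Z) = 0)%R ->
  (\sum_i (-1) ^+ t i * (1 - k%:Z * (c i)%:Z) * (a i)%:Z = 0)%R ->
  exists j, \sum_i a i = k * a j.
Proof.
move=> k_odd sum0 suma0.
have k_gt0 : 0 < k by case: k k_odd {t c a sum0 suma0}.
have sum1 : (\sum_(i < k) 1 = k%:Z)%R by rewrite sumr_const card_ord natz.
pose m := \sum_i (t i : nat).
have m_le : m <= k.
  by rewrite -[leqRHS]card_ord -sum1_card leq_sum // => i _; case: (t i).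
have t_const : exists e, forall i, t i = e.
  (* With m backward steps and q signed passages of the closing edge, the vanishing total change
     reads k - 2 m = k q. As k is odd, q is nonzero, and 0 <= m <= k leaves only m = 0 or m = k. *)
  pose q : int := (\sum_i (-1) ^+ t i * (c i)%:Z)%R.
  have eq_mq : (k%:Z - 2 * m%:Z = k%:Z * q)%R.
    apply/eqP; rewrite -subr_eq0 -[X in (_ == X)%R]sum0; apply/eqP.
    under [RHS]eq_bigr do rewrite mulrBr mulr1 mulrCA.
    rewrite sumrB -mulr_sumr; congr (_ - _)%R.
    rewrite (eq_bigr (fun i => 1%R - 2 * (t i : nat)%:Z)%R); last first.
      by move=> i _; case: (t i).
    by rewrite sumrB -mulr_sumr sum1 sum_Posz.
  have q_neq0 : q <> 0%R by move=> q0; move: eq_mq; rewrite q0; lia.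
  have [m0|mk] : m = 0 \/ m = k by nia.
    exists false => i; move/eqP: m0; rewrite sum_nat_eq0 => /forallP/(_ i).
    by case: (t i).
  exists true => i; have : \sum_i ~~ t i = 0.
    have : \sum_i (t i + ~~ t i) = k.
      rewrite -[RHS]card_ord -sum1_card; apply: eq_bigr => i' _.
      by case: (t i').
    by rewrite big_split /= -/m mk; lia.
  by move/eqP; rewrite sum_nat_eq0 => /forallP/(_ i); case: (t i).
have [e te] := t_const.
have drop_sign (F : 'I_k -> int) :
    (\sum_i (-1) ^+ t i * F i = 0 -> \sum_i F i = 0)%R.
  under eq_bigr do rewrite te.
  rewrite -mulr_sumr => /eqP.
  by rewrite mulf_eq0 signr_eq0 => /eqP.
(* Without signs, the total change is k minus k times the number of passages, so exactly one step j
   passes the closing edge. *)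
have sumc : \sum_i (c i : nat) = 1.
  move/drop_sign: sum0; rewrite sumrB -mulr_sumr sum1 sum_Posz.
  by nia.
have [j cj] : exists j, c j.
  apply/existsP; apply: contra_eqT sumc => /existsPn c0.
  by rewrite big1 // => i _; rewrite (negbTE (c0 i)).
exists j.
have c0 i : i != j -> c i = false.
  move=> ij; apply/negbTE; apply: contra_eqN sumc => ci.
  by rewrite (bigD1 j) // (bigD1 i) //= cj ci.
have /drop_sign :
    (\sum_i (-1) ^+ t i * ((1 - k%:Z * (c i)%:Z) * (a i)%:Z) = 0)%R.
  by rewrite -[RHS]suma0; apply: eq_bigr => i _; rewrite mulrA.
rewrite (eq_bigr (fun i => (a i)%:Z - k%:Z * ((c i)%:Z * (a i)%:Z))%R);
  last by move=> i _; rewrite mulrBl mul1r mulrA.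
rewrite sumrB -mulr_sumr sum_Posz.
rewrite [X in (_ * X)%R](bigD1 j) //= cj [X in (_ * (_ + X))%R]big1.
  by lia.
by move=> i ij; rewrite c0 ?mul0r.
Qed.

(** * Quadratic upper bound *)

(** Choosing an edge in each copy gives an injection into pairs of vertices, by
    edge-disjointness. *)
Lemma turan_le_sqr (F G : sgraph) (n : nat) :
  (exists x y : F, adj x y) -> multicolor_turan F G n <= n ^ 2.
Proof.
move=> [x [y Fxy]]; apply/bigmax_leqP => S /andP[/andP[/forall_inP copies]].
move=> /forall_inP disj _.
have [->//|/card_gt0P[H0 H0S]] := posnP #|S|.
(* A default pair for subgraphs outside S, read off from some copy of F. *)
have p0 : 'I_n * 'I_n.
  by have /existsP/sigW[f _] := copies H0 H0S; exact: (f x, f y).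
have ex (H : subgraph 'I_n) :
    exists p : 'I_n * 'I_n, H \in S -> [set p.1; p.2] \in H.2.
  have [HS|] := boolP (H \in S); last by exists p0.
  have /existsP[f /andP[_ /eqP Hf]] := copies H HS.
  exists (f x, f y) => _; rewrite Hf /=; apply/imsetP; exists [set x; y].
    by apply/imsetP; exists (x, y); rewrite ?inE.
  by rewrite imsetU !imset_set1.
have [h hP] := choice ex.
rewrite -(card_in_imset (f := h)).
  by rewrite (leq_trans (max_card _)) // card_prod card_ord mulnn.
move=> H H' HS HS' eq_h; apply/eqP; apply: contraT => HH'.
have /implyP/(_ HH')/disjointFr/(_ (hP H HS)) := forall_inP (disj H HS) H' HS'.
by rewrite eq_h hP.
Qed.

(** * Walking along cycles *)

(** Here t is the direction of the step and c tells whether it wraps around, which is the form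
    summed in [closed_walk_winds_once]. *)
Lemma cycle_step (k : nat) (i j : 'I_k) : 2 < k -> cycle_adj i j ->
  exists t c : bool, ((j%:Z - i%:Z) = (-1) ^+ t * (1 - k%:Z * c%:Z))%R.
Proof.
move=> k_gt2 /andP[_].
have step (a b : 'I_k) : ordS a == b ->
    exists c : bool, ((b%:Z - a%:Z) = (1 - k%:Z * c%:Z))%R.
  move=> /eqP <- /=; have [lt_ak|] := ltnP a.+1 k.
    by exists false; rewrite modn_small //; lia.
  move=> le_ka; have -> : a.+1 = k by have := ltn_ord a; lia.
  by exists true; rewrite modnn; have := ltn_ord a; lia.
move=> /orP[] /step[c ec]; first by exists false, c; rewrite mul1r.
by exists true, c; rewrite expr1 mulN1r -ec opprB.
Qed.

Lemma has_cycle_fun (G : sgraph) (k : nat) : has_cycle G k ->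
  exists v : 'I_k -> G, injective v /\ forall i, adj (v i) (v (ordS i)).
Proof.
move=> [k_gt2 [c [/andP[cyc uc] ck]]]; subst k.
have [x0 x0c] : exists x, x \in c.
  by case: (c) k_gt2 => [|x s] // _; exists x; rewrite mem_head.
exists (fun i => nth x0 c i); split.
  by move=> i j /eqP; rewrite nth_uniq // => /eqP/val_inj.
move=> i; have := next_cycle cyc (mem_nth x0 (ltn_ord i)).
rewrite next_nth mem_nth // index_uniq //.
case: c cyc uc x0c i {k_gt2} => [//|z c] cyc uc _ i.
rewrite [nth x0 _ (ordS i)]/= [size _]/=.
have [lt_i|le_i] := ltnP i.+1 (size c).+1.
  by rewrite modn_small // (set_nth_default x0 z) //=; lia.
(* At the last index, [next] falls back on the default z, the head of the cycle; this is the entry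
   at [ordS i], which is 0. *)
rewrite (nth_default z) //.
suff -> : i.+1 = (size c).+1 by rewrite modnn.
by apply/eqP; rewrite eqn_leq le_i andbT; exact: ltn_ord.
Qed.

Lemma cycle_adj_ordS (k : nat) (i : 'I_k) : 1 < k -> cycle_adj i (ordS i).
Proof.
move=> k_gt1.
rewrite /cycle_adj eqxx andbT -val_eqE /=; have := ltn_ord i.
have [lt_ik|ge_ik] := ltnP i.+1 k; first by rewrite modn_small //; lia.
by move=> i_lt; have -> : i.+1 = k by [lia]; rewrite modnn; lia.
Qed.

Lemma cycle_graph_has_cycle (k : nat) : 2 < k -> has_cycle (cycle_graph k) k.
Proof.
move=> k_gt2; split=> //; exists (enum 'I_k); split; last exact: size_enum_ord.
rewrite /ucycle enum_uniq andbT; apply: cycle_from_next => [|x _].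
  exact: enum_uniq.
suff x_next : next (enum 'I_k) x = ordS x.
  by rewrite x_next; apply: cycle_adj_ordS; lia.
apply/val_inj; rewrite next_nth mem_enum index_enum_ord /=.
case enumE : (enum 'I_k) => [|y p].
  by have := mem_enum 'I_k x; rewrite enumE.
have -> : nth y p x = nth y (enum 'I_k) x.+1 by rewrite enumE.
have [lt_xk|ge_xk] := ltnP x.+1 k; first by rewrite nth_enum_ord // modn_small.
rewrite nth_default ?size_enum_ord //.
have -> : x.+1 = k by apply/eqP; rewrite eqn_leq ge_xk ltn_ord.
have -> : y = nth y (enum 'I_k) 0 by rewrite enumE.
by rewrite modnn nth_enum_ord //; lia.
Qed.

(** * The packing and its lack of a rainbow copy *)

Lemma turan_ge_behrend (F G : sgraph) (k N n : nat) (A : {set 'I_N}) :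
  odd k -> (exists x y : F, adj x y) -> has_hom F (cycle_graph k) ->
  has_cycle G k ->
  (forall (a : 'I_k -> 'I_N) b, (forall i, a i \in A) -> b \in A ->
     \sum_i a i = k * b -> forall i, a i = b) ->
  #|F| * (k * N) <= n -> N * #|A| <= multicolor_turan F G n.
Proof.
move=> k_odd [x0 [y0 Fxy0]] [phi phi_hom] cycG A_free le_n.
have k_gt2 : 2 < k by case: cycG.
have k_gt0 : 0 < k by lia.
have card_le : #|{: F * 'I_(k * N)}| <= n by rewrite card_prod card_ord.
pose iota (w : F * 'I_(k * N)) : 'I_n := widen_ord card_le (enum_rank w).
have iota_inj : injective iota.
  by move=> w w' /(congr1 val) /= /val_inj /enum_rank_inj.
(* The largest position is (N - 1) + (k - 1) (N - 1), which explains the range k N. *)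
have pos_lt (p : 'I_N * 'I_N) (u : F) : p.1 + phi u * p.2 < k * N.
  have := ltn_ord p.1; have := ltn_ord p.2; have := ltn_ord (phi u).
  move: (phi u : nat) (p.1 : nat) (p.2 : nat) => i x a.
  by nia.
pose pl (p : 'I_N * 'I_N) (u : F) : 'I_n := iota (u, Ordinal (pos_lt p u)).
have plE p u p' u' : pl p u = pl p' u' ->
    u = u' /\ p.1 + phi u * p.2 = p'.1 + phi u' * p'.2.
  by move=> /iota_inj [-> e]; rewrite e.
have pl_inj p : injective (pl p) by move=> u u' /plE[].
have step u u' : adj u u' ->
    exists t c : bool,
      ((phi u')%:Z - (phi u)%:Z = (-1) ^+ t * (1 - k%:Z * c%:Z))%R.
  by move/phi_hom/(cycle_step k_gt2).
have phi_neq u u' : adj u u' -> phi u != phi u' :> nat.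
  by move/phi_hom => /andP[]; rewrite -val_eqE.
(* Subtracting the two position equations gives (phi u - phi u') (a - a') = 0, and phi separates
   adjacent vertices. *)
have two_points p p' u u' : adj u u' -> pl p u = pl p' u ->
    pl p u' = pl p' u' -> p = p'.
  move=> /phi_neq + /plE[_ e1] /plE[_ e2].
  case: p p' e1 e2 => [x a] [x' a'] /= e1 e2 ne.
  have aa' : a = a' :> nat by nia.
  by congr pair; apply/val_inj => //=; move: e1; rewrite aa'; lia.
pose cp p : subgraph 'I_n := image_subgraph (pl p).
have edgeP p e : reflect (exists u u', adj u u' /\ e = [set pl p u; pl p u'])
    (e \in (cp p).2).
  apply: (iffP imsetP) => [[_ /imsetP[[u u'] /[!inE] uu' ->] ->]|].
    by exists u, u'; rewrite imsetU !imset_set1.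
  move=> [u [u' [uu' ->]]]; exists [set u; u']; last first.
    by rewrite imsetU !imset_set1.
  by apply/imsetP; exists (u, u'); rewrite ?inE.
(* A point of a copy determines its vertex of F, so the endpoints of a shared edge are matched
   consistently and [two_points] applies. *)
have edge_color p p' e : e \in (cp p).2 -> e \in (cp p').2 -> p = p'.
  move=> /edgeP[u [u' [uu' ->]]] /edgeP[v [v' [vv']]].
  move=> e2; have := set21 (pl p u) (pl p u'); have := set22 (pl p u) (pl p u').
  rewrite e2 !inE.
  have uNu' : u != u' by apply: contraTneq uu' => ->; rewrite adj_irrefl.
  case/orP=> /eqP E1; case/orP=> /eqP E2.
  - by have [? _] := plE _ _ _ _ E1; have [? _] := plE _ _ _ _ E2;
       subst; rewrite eqxx in uNu'.
  - have [? _] := plE _ _ _ _ E1; have [? _] := plE _ _ _ _ E2; subst.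
    exact: two_points E2 E1.
  - have [? _] := plE _ _ _ _ E1; have [? _] := plE _ _ _ _ E2; subst.
    exact: two_points E2 E1.
  - by have [? _] := plE _ _ _ _ E1; have [? _] := plE _ _ _ _ E2;
       subst; rewrite eqxx in uNu'.
have edge0 p : [set pl p x0; pl p y0] \in (cp p).2.
  by apply/edgeP; exists x0, y0.
have cp_inj : injective cp.
  move=> p p' pp'; apply: (@edge_color p p' [set pl p x0; pl p y0]) => //.
  by rewrite -pp'.
pose P := [set p : 'I_N * 'I_N | p.2 \in A].
have cardP : #|P| = N * #|A|.
  rewrite -[X in X * _](card_ord N) -cardsT -cardsX; apply: eq_card => p.
  by rewrite !inE.
rewrite -cardP -(card_imset (mem P) cp_inj).
apply: (@leq_bigmax_cond _ _ (fun S : {set subgraph 'I_n} => #|S|)).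
apply/andP; split.
  apply/andP; split.
    apply/forall_inP => _ /imsetP[p _ ->]; apply/existsP.
    exists [ffun u => pl p u]; apply/andP; split.
      by apply/injectiveP => u u'; rewrite !ffunE => /pl_inj.
    apply/eqP; rewrite /cp /image_subgraph; congr pair.
      by apply: eq_imset => u; rewrite ffunE.
    apply: eq_imset => e; by apply: eq_imset => u; rewrite ffunE.
  apply/forall_inP => _ /imsetP[p _ ->].
  apply/forall_inP => _ /imsetP[p' _ ->].
  apply/implyP; apply: contraR => /pred0Pn[e /andP[ep ep']].
  by rewrite (edge_color _ _ _ ep ep').
apply/negP => /existsP[g /existsP[c /and3P[/injectiveP g_inj /forall_inP col]]].
move=> /forall_inP rainbow.
have [v [v_inj v_adj]] := has_cycle_fun cycG.
pose e i := [set v i; v (ordS i)].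
have eG i : e i \in edges G.
  by apply/imsetP; exists (v i, v (ordS i)); rewrite ?inE /=.
(* For each cycle edge, z holds the parameters of its copy and the edge of F behind it, oriented
   along the cycle. *)
have ex (i : 'I_k) : exists z : ('I_N * 'I_N) * (F * F),
    [/\ z.1.2 \in A, c (e i) = cp z.1, adj z.2.1 z.2.2,
        g (v i) = pl z.1 z.2.1 & g (v (ordS i)) = pl z.1 z.2.2].
  have /andP[/imsetP[p /[!inE] pA cE]] := col _ (eG i).
  rewrite cE => /edgeP[u [u' [uu' eE]]].
  have vN : v (ordS i) != v i.
    by apply: contraTneq (v_adj i) => ->; rewrite adj_irrefl.
  have := eE; rewrite imsetU !imset_set1 => {}eE.
  have := set21 (g (v i)) (g (v (ordS i))).
  have := set22 (g (v i)) (g (v (ordS i))).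
  rewrite eE !inE => /orP[] /eqP E1 /orP[] /eqP E2.
  - by rewrite (g_inj _ _ (etrans E1 (esym E2))) eqxx in vN.
  - by exists (p, (u', u)); rewrite adj_sym.
  - by exists (p, (u, u')).
  - by rewrite (g_inj _ _ (etrans E1 (esym E2))) eqxx in vN.
have [z zP] := choice ex.
(* Consecutive copies meet in the image of [v (ordS i)], so they agree there on the vertex of F and
   on the position. *)
pose p i := (z i).1; pose u i := (z i).2.1.
have glue i : (z i).2.2 = u (ordS i) /\
    (p i).1 + phi (u (ordS i)) * (p i).2 =
    (p (ordS i)).1 + phi (u (ordS i)) * (p (ordS i)).2.
  have [_ _ _ _ E1] := zP i; have [_ _ _ E2 _] := zP (ordS i).
  have [e1 e2] := plE _ _ _ _ (etrans (esym E1) E2).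
  by split; [|rewrite -e2 e1].
have uadj i : adj (u i) (u (ordS i)).
  by have [_ _ + _ _] := zP i; rewrite (glue i).1.
have ex_tc i : exists tc : bool * bool,
    ((phi (u (ordS i)))%:Z - (phi (u i))%:Z =
     (-1) ^+ tc.1 * (1 - k%:Z * (tc.2 : nat)%:Z))%R.
  by have [t [b tb]] := step _ _ (uadj i); exists (t, b).
have [tc tcP] := choice ex_tc.
have telescope (h : 'I_k -> int) : (\sum_i (h (ordS i) - h i) = 0)%R.
  rewrite sumrB [X in (_ - X)%R](reindex (@ordS k)) ?subrr //.
  exact/onW_bij/ordS_bij.
have [j sum_a] : exists j, \sum_i ((p i).2 : nat) = k * (p j).2.
  apply: (@closed_walk_winds_once k (fun i => (tc i).1)
    (fun i => (tc i).2)) => //.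
    by under eq_bigr do rewrite -tcP; rewrite telescope.
  under eq_bigr do rewrite -tcP.
  (* By [glue], the position x_i + phi(u_i) a_i changes by (phi(u_(i+1)) - phi(u_i)) a_i from i to i
     + 1. *)
  rewrite -[RHS](telescope
    (fun i => (p i).1%:Z + (phi (u i))%:Z * (p i).2%:Z)%R).
  apply: eq_bigr => i _; rewrite -!PoszM -!PoszD -(glue i).2.
  by lia.
have pA i : (p i).2 \in A by have [] := zP i.
have a_const i : (p i).2 = (p j).2.
  exact: (A_free (fun i => (p i).2) (p j).2).
pose i0 := Ordinal k_gt0.
(* With all a_i equal, [glue] also equates the x-coordinates. Two consecutive cycle edges then get
   one color, although they differ as k > 2. *)
have same_p : p i0 = p (ordS i0).
  have := (glue i0).2; rewrite [p i0]surjective_pairing.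
  rewrite [p (ordS i0)]surjective_pairing /= !a_const => /addIn E; congr pair.
  exact/val_inj.
have : e i0 = e (ordS i0).
  apply/eqP; have /forall_inP/(_ _ (eG (ordS i0)))/implyP := rainbow _ (eG i0).
  apply; have [_ -> _ _ _] := zP i0; have [_ -> _ _ _] := zP (ordS i0).
  by rewrite -/(p i0) same_p.
move=> e01; have := set21 (v i0) (v (ordS i0)); rewrite -/(e i0) e01 !inE.
by case/orP => /eqP/v_inj/(congr1 val) /=; rewrite !modn_small; lia.
Qed.

Local Open Scope classical_set_scope.
Local Open Scope nat_scope.

(** * From polynomial bounds to the exponent *)

(** Taking delta = 2 - ln f / ln n makes the equality exact once f > 0 and n > 1. The upper bound
    gives delta >= 0, the lower one delta <= 2 / D + ln C / (D ln n). *)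
Lemma eq_n2_o1_of_bounds (R : realType) (f : nat -> nat) :
  (forall n, f n <= n ^ 2) ->
  (forall D, 0 < D -> exists C, forall n, C <= n ->
     n ^ (2 * D - 2) <= f n ^ D * C) ->
  eq_n2_o1 R f.
Proof.
move=> f_le f_ge.
pose delta (n : nat) : R := (2 - ln (f n)%:R / ln (n%:R : R))%R.
(* The case D = 1 of the lower bound reads 1 <= f n * C. *)
have f_gt0 : \forall n \near \oo, 0 < f n.
  have [C CP] := f_ge 1 isT; near=> n.
  have /CP : C <= n by near: n; apply: nbhs_infty_ge.
  by rewrite muln1 subnn expn0 expn1 muln_gt0 => /andP[].
exists delta; split; last first.
  near=> n.
  have fn : 0 < f n by near: n.
  have n_gt1 : 1 < n by near: n; apply: nbhs_infty_gt.
  have lnn : (0 < ln n%:R :> R)%R by rewrite ln_gt0 // ltr1n.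
  rewrite /delta opprB addrC subrK /powR pnatr_eq0 gtn_eqF ?(ltnW n_gt1) //.
  by rewrite divfK ?gt_eqF // lnK // posrE ltr0n.
apply/cvgrPdist_le => /= e e_gt0.
(* D > 4 / e makes 2 / D less than e / 2; the later condition on n makes ln C / ln n at most e /
   2. *)
have [D De] : exists D : nat, (4 / e < D%:R)%R.
  by exists (Num.bound (4 / e)); apply: archi_boundP; rewrite divr_ge0 // ltW.
have D_gt0 : (0 < D%:R :> R)%R.
  by apply: le_lt_trans De; rewrite divr_ge0 // ltW.
have [C CP] := f_ge D ltac:(by rewrite -(ltr0n R)).
near=> n.
have fn : 0 < f n by near: n.
have n_gt1 : 1 < n by near: n; apply: nbhs_infty_gt.
have Cn : C <= n by near: n; apply: nbhs_infty_ge.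
have lnn : (0 < ln n%:R :> R)%R by rewrite ln_gt0 // ltr1n.
have npos : (0 < n%:R :> R)%R by rewrite ltr0n ltnW.
have C_gt0 : 0 < C.
  have := CP n Cn; rewrite lt0n; apply: contraTneq => ->.
  by rewrite muln0 -ltnNge expn_gt0 ltnW.
have lnC : (2 * ln C%:R / e <= ln n%:R :> R)%R.
  rewrite -[leLHS]expRK ler_ln ?posrE ?expR_gt0 //.
  by near: n; apply: nbhs_infty_ger.
have fpos : (0 < (f n)%:R :> R)%R by rewrite ltr0n.
have ub : (ln (f n)%:R <= 2 * ln n%:R :> R)%R.
  rewrite mulrC mulr_natr -lnXn // ler_ln ?posrE ?exprn_gt0 //.
  by rewrite -natrX ler_nat.
have lb : ((2 * D%:R - 2) * ln n%:R <= D%:R * ln (f n)%:R + ln C%:R :> R)%R.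
  have -> : ((2 * D%:R - 2) * ln n%:R = ln (n%:R ^+ (2 * D - 2)) :> R)%R.
    rewrite lnXn // -[RHS]mulr_natl natrB ?natrM //.
    by rewrite leq_pmulr // -(ltr0n R).
  have -> : (D%:R * ln (f n)%:R + ln C%:R = ln ((f n)%:R ^+ D * C%:R) :> R)%R.
    by rewrite lnM ?posrE ?exprn_gt0 ?ltr0n // lnXn // mulr_natl.
  rewrite ler_ln ?posrE ?mulr_gt0 ?exprn_gt0 ?ltr0n ?(ltnW n_gt1) //.
  by rewrite -!natrX -natrM ler_nat CP.
rewrite sub0r normrN ger0_norm; last first.
  by rewrite subr_ge0 ler_pdivrMr.
rewrite /delta lerBlDr -lerBlDl ler_pdivlMr //.
move: De lnC; rewrite ltr_pdivrMr // ler_pdivrMr // => De lnC.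
rewrite -(ler_pM2l D_gt0).
have : (4 * ln n%:R <= D%:R * e * ln n%:R :> R)%R by rewrite ler_pM2r // ltW.
have D_ge1 : (1 <= D%:R :> R)%R by rewrite ler1n -(ltr0n R).
have : (e * ln n%:R <= D%:R * (e * ln n%:R) :> R)%R.
  by rewrite ler_peMl // mulr_ge0 // ltW.
by lra.
Unshelve. all: by end_near.
Qed.

(** * Choice of parameters and conclusion *)

Lemma turan_eq_n2_o1 (R : realType) (F G : sgraph) (k : nat) :
  odd k -> (exists x y : F, adj x y) -> has_hom F (cycle_graph k) ->
  has_cycle G k -> eq_n2_o1 R (multicolor_turan F G).
Proof.
move=> k_odd edgeF homF cycG.
have F_gt0 : 0 < #|F| by have [x _] := edgeF; apply/card_gt0P; exists x.
have k_gt0 : 0 < k by case: k k_odd {homF cycG}.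
apply: eq_n2_o1_of_bounds => [n|D D_gt0]; first exact: turan_le_sqr.
have [L LE] : exists L, L = #|F| * k * k by exists (#|F| * k * k).
have L_gt0 : 0 < L by rewrite LE !muln_gt0 F_gt0 k_gt0.
(* The factor L^D forces n >= L^D, hence d >= 1 below. The rest comes from n < (2 L d)^D and d^(2 D
   - 2) <= f D, raised to the powers 2 D - 2 and D. *)
exists (L ^ D * (D ^ D * (2 * L) ^ (D * (2 * D - 2)))) => n le_n.
have ex_d : exists d, (L * d) ^ D <= n by exists 0; rewrite muln0 exp0n.
have d_le d : (L * d) ^ D <= n -> d <= n.
  apply: leq_trans; rewrite -(prednK D_gt0) expnS -mulnA.
  have [->//|d_gt0] := posnP d.
  apply: leq_trans (leq_pmull _ L_gt0); rewrite leq_pmulr // expn_gt0.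
  by rewrite muln_gt0 L_gt0 d_gt0.
case: (ex_maxnP ex_d d_le) => d dP d_max.
have d_gt0 : 0 < d.
  apply: d_max; rewrite muln1; apply: leq_trans le_n.
  by rewrite leq_pmulr // !(muln_gt0, expn_gt0) D_gt0 L_gt0.
have n_lt : n < (2 * L * d) ^ D.
  rewrite ltnNge; apply/negP => le_n'.
  have /d_max : (L * (2 * d)) ^ D <= n by rewrite mulnCA mulnA.
  by lia.
have [A [A_big A_free]] := behrend k_gt0 D_gt0 d_gt0.
(* Since D >= 1, |F| k is at most (|F| k)^D, so L^D d^D covers the required number of vertices. *)
have fit : #|F| * (k * (k * d) ^ D) <= n.
  apply: leq_trans dP; rewrite LE !expnMn !mulnA leq_pmul2r ?expn_gt0 ?d_gt0 //.
  rewrite leq_pmul2r ?expn_gt0 ?k_gt0 //.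
  by apply: leq_mul; rewrite -[leqLHS]expn1 leq_pexp2l.
have := turan_ge_behrend k_odd edgeF homF cycG A_free fit.
set f := multicolor_turan F G n => f_ge.
have f_big : d ^ (2 * D - 2) <= f * D.
  have dd : 0 < d ^ 2 by rewrite expn_gt0 d_gt0.
  rewrite -(leq_pmul2r dd) -expnD subnK ?mul2n -?addnn ?expnD; last by lia.
  apply: (@leq_trans ((k * d) ^ D * (#|A| * (D * d ^ 2)))).
    by apply: leq_mul => //; rewrite leq_exp2r // leq_pmull.
  by rewrite mulnA -[leqRHS]mulnA leq_mul2r f_ge orbT.
apply: (@leq_trans ((2 * L * d) ^ (D * (2 * D - 2)))).
  rewrite expnM; move: (2 * D - 2) => m.
  by case: m => [//|m]; rewrite leq_exp2r // ltnW.
have -> : (2 * L * d) ^ (D * (2 * D - 2)) =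
    (2 * L) ^ (D * (2 * D - 2)) * (d ^ (2 * D - 2)) ^ D.
  by rewrite expnMn -(expnM d) [(2 * D - 2) * D]mulnC.
have : (d ^ (2 * D - 2)) ^ D <= (f * D) ^ D by rewrite leq_exp2r.
rewrite expnMn => le_fD.
rewrite mulnCA (leq_trans _ (leq_pmull _ _)) ?expn_gt0 ?L_gt0 //.
by rewrite mulnA [leqRHS]mulnC leq_mul2l le_fD orbT.
Qed.

Theorem theorem1p6 (R : realType) :
  (forall (F G : sgraph) (k : nat),
     odd_girth F k -> odd_girth G k ->
     has_hom F (cycle_graph k) -> has_hom G (cycle_graph k) ->
     eq_n2_o1 R (multicolor_turan F G)) /\
  (forall k : nat, odd k -> 3 <= k ->
     eq_n2_o1 R (multicolor_turan (cycle_graph k) (cycle_graph k))).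
Proof.
split=> [F G k [k_odd [k_gt2 [c [cyc sz]]] _] [_ cycG _] homF _|k k_odd k_ge3].
  apply: (turan_eq_n2_o1 R k_odd _ homF cycG).
  have [v [_ v_adj]] := has_cycle_fun (conj k_gt2 (ex_intro _ c (conj cyc sz))).
  have i : 'I_k by exists 0; lia.
  by exists (v i), (v (ordS i)).
apply: (@turan_eq_n2_o1 R _ _ k k_odd).
- have i : 'I_k by exists 0; lia.
  by exists i, (ordS i); apply: cycle_adj_ordS; lia.
- by exists id.
exact: cycle_graph_has_cycle.
Qed.
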